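(* Let $(M,h)$ be a closed Riemannian spin manifold, let $\kappa\in\mathbb{R}$, and let $(\phi,\psi)$ be a smooth $\kappa$-Dirac-harmonic map from $M$ to the round sphere $S^n\subset\mathbb{R}^{n+1}$. Then for all $i,m\in\{1,\dots,n+1\}$ the vector field on $M$ with components $$J_\alpha^{im}:=\operatorname{Re}\langle e_\alpha\cdot\psi^i,\psi^m\rangle_{\Sigma M}+(\phi^i_\alpha\phi^m-\phi^i\phi^m_\alpha)$$ is divergence free.
   Context: $\Sigma M$ is the spinor bundle of $(M,h)$ with hermitian scalar product $\langle\cdot,\cdot\rangle_{\Sigma M}$ (taken conjugate-linear in the first and linear in the second slot) and metric spin connection $\nabla^{\Sigma M}$. Clifford multiplication by tangent vectors is skew-symmetric, $\langle\psi,X\cdot\eta\rangle=-\langle X\cdot\psi,\eta\rangle$, and satisfies $X\cdot Y\cdot\psi+Y\cdot X\cdot\psi=-2h(X,Y)\psi$. $(e_\alpha)$ is a local orthonormal frame of $TM$, $\not\partial=e_\alpha\cdot\nabla^{\Sigma M}_{e_\alpha}$ is the Dirac operator on $\Sigma M$, repeated indices are summed, and $\phi^j_\alpha:=d\phi^j(e_\alpha)$. $\Delta$ is the Laplace-Beltrami operator $\operatorname{div}\nabla$ on functions. A map to $S^n$ is written $\phi=(\phi^1,\dots,\phi^{n+1})$ with $|\phi|=1$, and a vector spinor along $\phi$ (a section of $\Sigma M\otimes\phi^\ast TS^n$) is written $\psi=(\psi^1,\dots,\psi^{n+1})$ with each $\psi^i$ a section of $\Sigma M$ and $\sum_i\phi^i\psi^i=0$;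 $|\psi|^2=\sum_i|\psi^i|^2$. A smooth $\kappa$-Dirac-harmonic map from $M$ to $S^n$ is a smooth pair $(\phi,\psi)$ of this kind solving, for $i=1,\dots,n+1$, $$-\Delta\phi^i=|d\phi|^2\phi^i+\operatorname{Re}\langle\psi^i,e_\alpha\cdot\psi^j\rangle_{\Sigma M}\phi^j_\alpha,$$ $$\not\partial\psi^i=-\phi^j_\alpha\,\phi^i\, e_\alpha\cdot\psi^j-2\kappa\big(|\psi|^2\psi^i-\langle\psi^j,\psi^i\rangle_{\Sigma M}\psi^j\big).$$ *)

(* Defs.v *)
From HB Require Import structures.
From mathcomp Require Import all_boot all_order all_algebra.
From mathcomp Require Import complex.
From mathcomp Require Import all_classical all_reals all_analysis.
Set Implicit Arguments.
Unset Strict Implicit.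
Unset Printing Implicit Defensive.
Import Order.TTheory GRing.Theory Num.Theory.
Import numFieldNormedType.Exports.
Local Open Scope classical_set_scope.
Local Open Scope ring_scope.
Local Open Scope complex_scope.

(** Tangent vectors and vectors of R^m are row vectors; spinors are column
    vectors.  Throughout, [c], [d] index charts and [a], [b] index local
    trivializations of the spin structure. *)

Section Manifold.
Variables (R : realType) (m : nat).

(* C^infinity on an open set V: every iterated directional derivative is
   (Frechet) differentiable on V. *)
Definition smooth_on (W : normedModType R) (V : set 'rV[R]_m)
    (f : 'rV[R]_m -> W) : Prop :=
  forall (s : seq 'rV[R]_m) x, V x ->
    differentiable (foldr (fun v g => 'D_v g) f s) x.

(* An m-dimensional smooth manifold without boundary.  Being Hausdorff and
   compact is not part of the record. *)
Record smooth_atlas (M : topologicalType) := SmoothAtlas {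
  chart_index : Type;
  chart_dom : chart_index -> set M;
  chart : chart_index -> M -> 'rV[R]_m;
  chart_inv : chart_index -> 'rV[R]_m -> M;
  chart_dom_open : forall c, open (chart_dom c);
  chart_image_open : forall c, open (chart c @` chart_dom c);
  chartK : forall c p, chart_dom c p -> chart_inv c (chart c p) = p;
  chart_continuous : forall c p, chart_dom c p -> {for p, continuous (chart c)};
  chart_inv_continuous : forall c p, chart_dom c p ->
    {for chart c p, continuous (chart_inv c)};
  chart_cover : forall p, exists c, chart_dom c p;
  chart_transition_smooth : forall c d,
    smooth_on (chart c @` (chart_dom c `&` chart_dom d))
              (chart d \o chart_inv c) }.

Variables (M : topologicalType) (A : smooth_atlas M).
Local Notation I := (chart_index A).

Definition smooth_fun (U : set M) (f : M -> R) : Prop :=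
  forall c : I, smooth_on (chart c @` (U `&` chart_dom c)) (f \o chart_inv c).

Definition smooth_cfun (U : set M) (f : M -> R[i]) : Prop :=
  smooth_fun U (fun p => complex.Re (f p))
  /\ smooth_fun U (fun p => complex.Im (f p)).

(* [dirder c v f p] is v(f) at p, for v a tangent vector at p given by its
   components in the chart c. *)
Definition dirder (c : I) (v : 'rV[R]_m) (f : M -> R) (p : M) : R :=
  'D_v (f \o chart_inv c) (chart c p).

Definition partial (c : I) (k : 'I_m) (f : M -> R) (p : M) : R :=
  dirder c (delta_mx 0 k) f p.

Definition transition_jacobian (c d : I) (p : M) : 'M[R]_m :=
  'J (chart d \o chart_inv c) (chart c p).

(* A vector field is the family of its component vectors in the charts,
   [X c p] being meaningful for p in the domain of c. *)
Definition vector_field_on (U : set M) (X : I -> M -> 'rV[R]_m) : Prop :=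
  (forall c d p, U p -> chart_dom c p -> chart_dom d p ->
     X d p = X c p *m transition_jacobian c d p)
  /\ (forall c k, smooth_on (chart c @` (U `&` chart_dom c))
                   (fun x => X c (chart_inv c x) 0 k)).

Record riemannian_metric := RiemannianMetric {
  metric : I -> M -> 'M[R]_m;
  metric_sym : forall c p, chart_dom c p -> (metric c p)^T = metric c p;
  metric_pos : forall c p (v : 'rV[R]_m), chart_dom c p -> v != 0 ->
    0 < (v *m metric c p *m v^T) 0 0;
  metric_smooth : forall c k l, smooth_on (chart c @` chart_dom c)
                    (fun x => metric c (chart_inv c x) k l);
  metric_transition : forall c d p, chart_dom c p -> chart_dom d p ->
    metric c p = transition_jacobian c d p *m metric d p
                 *m (transition_jacobian c d p)^T }.

Variable h : riemannian_metric.

Definition inner (c : I) (p : M) (u v : 'rV[R]_m) : R :=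
  (u *m metric h c p *m v^T) 0 0.

(* Gamma^k_{jl} *)
Definition christoffel (c : I) (p : M) (k j l : 'I_m) : R :=
  2^-1 * \sum_(q < m) invmx (metric h c p) k q *
    (partial c j (fun x => metric h c x q l) p
     + partial c l (fun x => metric h c x q j) p
     - partial c q (fun x => metric h c x j l) p).

(* Components in the chart c of the Levi-Civita derivative of Y along v at p,
   Y being a vector field given by its components in c. *)
Definition levi_civita (c : I) (v : 'rV[R]_m) (Y : M -> 'rV[R]_m) (p : M) :
    'rV[R]_m :=
  \row_k (dirder c v (fun x => Y x 0 k) p
          + \sum_(j < m) \sum_(l < m)
              christoffel c p k j l * v 0 j * Y p 0 l).

(* div Y = tr (v |-> nabla_v Y) *)
Definition divergence (c : I) (Y : M -> 'rV[R]_m) (p : M) : R :=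
  \sum_(k < m) levi_civita c (delta_mx 0 k) Y p 0 k.

Definition gradient (c : I) (f : M -> R) (p : M) : 'rV[R]_m :=
  (\row_k partial c k f p) *m invmx (metric h c p).

Definition laplacian (c : I) (f : M -> R) (p : M) : R :=
  divergence c (gradient c f) p.

End Manifold.

Section Clifford.
Variables (R : realType) (m : nat).

(* 2 ^ floor(m/2), the complex rank of the spinor bundle *)
Definition spinor_dim : nat := (2 ^ m./2)%N.

Definition spinor_prod (u v : 'cV[R[i]]_spinor_dim) : R[i] :=
  ((map_mx conjc u)^T *m v) 0 0.

(* A complex spinor module: matrices gamma_1, ..., gamma_m of the Clifford
   multiplications by the standard basis of R^m.  In this dimension such a
   representation of the Clifford algebra is automatically irreducible (one of
   the two irreducible ones when m is odd; they agree on the spin group). *)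
Record spinor_module := SpinorModule {
  gamma : 'I_m -> 'M[R[i]]_spinor_dim;
  gamma_clifford : forall j k,
    gamma j *m gamma k + gamma k *m gamma j = (- (2 * (j == k)%:R))%:M;
  gamma_skew : forall j, (map_mx conjc (gamma j))^T = - gamma j }.

Variable rho : spinor_module.

Definition clifford (v : 'rV[R]_m) : 'M[R[i]]_spinor_dim :=
  \sum_(j < m) (v 0 j)%:C *: gamma rho j.

(* The (faithful) image of Spin(m) in the spinor module: products of an even
   number of unit vectors. *)
Inductive spin_group : 'M[R[i]]_spinor_dim -> Prop :=
| spin_one : spin_group 1%:M
| spin_mul (u v : 'rV[R]_m) (g : 'M[R[i]]_spinor_dim) :
    u *m u^T = 1%:M -> v *m v^T = 1%:M -> spin_group g ->
    spin_group (clifford u *m clifford v *m g).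

End Clifford.

Section Spin.
Variables (R : realType) (m : nat) (M : topologicalType).
Variables (A : smooth_atlas R m M) (h : riemannian_metric A).
Variable rho : spinor_module R m.
Local Notation I := (chart_index A).
Local Notation N := (spinor_dim m).

(* The principal Spin(m)-bundle over the frame bundle of (M,h), given by local
   sections s_a: [frame a] is the orthonormal frame under s_a, [lift a b] is
   the Spin(m)-valued transition function with s_b = s_a . lift a b, and
   [lift_frame] says that Ad (lift a b) is the transition function of the
   frames.  The frames are thereby consistently oriented, since
   Ad (Spin(m)) = SO(m). *)
Record spin_structure := SpinStructure {
  triv : Type;
  triv_dom : triv -> set M;
  frame : triv -> 'I_m -> I -> M -> 'rV[R]_m;
  lift : triv -> triv -> M -> 'M[R[i]]_N;
  triv_dom_open : forall a, open (triv_dom a);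
  triv_cover : forall p, exists a, triv_dom a p;
  frame_vector_field : forall a al, vector_field_on (triv_dom a) (frame a al);
  frame_orthonormal : forall a c p al be, triv_dom a p -> chart_dom c p ->
    inner h c p (frame a al c p) (frame a be c p) = (al == be)%:R;
  lift_spin : forall a b p, triv_dom a p -> triv_dom b p ->
    spin_group rho (lift a b p);
  lift_smooth : forall a b j k,
    smooth_cfun A (triv_dom a `&` triv_dom b) (fun p => lift a b p j k);
  lift_cocycle : forall a b a' p, triv_dom a p -> triv_dom b p ->
    triv_dom a' p -> lift a b p *m lift b a' p = lift a a' p;
  lift_frame : forall a b c p be, triv_dom a p -> triv_dom b p ->
    chart_dom c p ->
    lift a b p *m gamma rho be =
    clifford rho (\row_al inner h c p (frame a al c p) (frame b be c p))
      *m lift a b p }.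

Variable S : spin_structure.

(* Smooth sections of the spinor bundle, i.e. of the bundle associated to the
   spin structure by the spinor module, through their components in the
   trivializations. *)
Record spinor_field := SpinorField {
  spinor :> triv S -> M -> 'cV[R[i]]_N;
  spinor_transition : forall a b p, triv_dom a p -> triv_dom b p ->
    spinor a p = lift a b p *m spinor b p;
  spinor_smooth : forall a k,
    smooth_cfun A (triv_dom a) (fun p => spinor a p k 0) }.

(* f_alpha = df(e_alpha) *)
Definition frameder (c : I) (a : triv S) (al : 'I_m) (f : M -> R) (p : M) : R :=
  dirder c (frame a al c p) f p.

(* nabla_{e_alpha} psi =
     e_alpha(psi)
     + 1/4 sum_{beta,delta} h(nabla_{e_alpha} e_beta, e_delta)
                            e_beta . e_delta . psi,
   the connection induced on the spinor bundle by the Levi-Civita connection *)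
Definition spin_connection (c : I) (a : triv S) (al : 'I_m)
    (psi : spinor_field) (p : M) : 'cV[R[i]]_N :=
  \col_k (frameder c a al (fun x => complex.Re (psi a x k 0)) p
          +i* frameder c a al (fun x => complex.Im (psi a x k 0)) p)
  + \sum_(be < m) \sum_(de < m)
      (4^-1 * inner h c p
                (levi_civita h c (frame a al c p) (frame a be c) p)
                (frame a de c p))%:C
      *: (gamma rho be *m gamma rho de *m psi a p).

Definition dirac (c : I) (a : triv S) (psi : spinor_field) (p : M) :
    'cV[R[i]]_N :=
  \sum_(al < m) gamma rho al *m spin_connection c a al psi p.

Variables (n : nat) (kappa : R).

(* Equations are required in every chart c and every trivialization a around
   the point; by invariance one of each would do. *)
Record dirac_harmonic_map (phi : 'I_n.+1 -> M -> R)
    (psi : 'I_n.+1 -> spinor_field) : Prop := DiracHarmonicMap {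
  dh_smooth : forall i, smooth_fun A setT (phi i);
  dh_sphere : forall p, \sum_(i < n.+1) phi i p ^+ 2 = 1;
  dh_tangent : forall a p, triv_dom a p ->
    \sum_(i < n.+1) (phi i p)%:C *: psi i a p = 0;
  dh_map_equation : forall c a p i, chart_dom c p -> triv_dom a p ->
    - laplacian h c (phi i) p =
    (\sum_(j < n.+1) \sum_(al < m) frameder c a al (phi j) p ^+ 2) * phi i p
    + \sum_(al < m) \sum_(j < n.+1)
        complex.Re (spinor_prod (psi i a p) (gamma rho al *m psi j a p))
        * frameder c a al (phi j) p;
  dh_dirac_equation : forall c a p i, chart_dom c p -> triv_dom a p ->
    dirac c a (psi i) p =
    - (\sum_(al < m) \sum_(j < n.+1)
         (frameder c a al (phi j) p * phi i p)%:C
         *: (gamma rho al *m psi j a p))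
    - (2 * kappa)%:C *:
        ((\sum_(j < n.+1) spinor_prod (psi j a p) (psi j a p)) *: psi i a p
         - \sum_(j < n.+1)
             spinor_prod (psi j a p) (psi i a p) *: psi j a p) }.

End Spin.

(* Main.v *)
Require Import Defs.
From HB Require Import structures.
From mathcomp Require Import all_boot all_order all_algebra.
From mathcomp Require Import complex.
From mathcomp Require Import all_classical all_reals all_analysis.
From mathcomp Require Import ring.
Set Implicit Arguments.
Unset Strict Implicit.
Unset Printing Implicit Defensive.
Import Order.TTheory GRing.Theory Num.Theory.
Import numFieldNormedType.Exports.
Local Open Scope classical_set_scope.
Local Open Scope ring_scope.
Local Open Scope complex_scope.

(** The vector field J is the Noether current of the rotation of R^(n+1) in the
    (i,k)-plane.  Its second part is phi^k grad phi^i - phi^i grad phi^k, with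
    divergence phi^k Laplacian(phi^i) - phi^i Laplacian(phi^k).  Metric
    compatibility makes the connection coefficients h(nabla_al e_be, e_de) of an
    orthonormal frame antisymmetric in be and de, so that the spin connection
    is given by skew-adjoint matrices Om_al with
    sum_al [Om_al, gamma_al] = - sum_be div(e_be) gamma_be; hence the first part
    has divergence Re <D psi^i, psi^k> - Re <psi^i, D psi^k>, D being the Dirac
    operator.  Once the equations are substituted, the curvature term
    |d phi|^2 phi and the kappa term drop out by their symmetry in (i,k), and
    the remaining mixed terms cancel. *)

Lemma near_eq_differentiable (K : numFieldType) (V W : normedModType K)
    (f g : V -> W) (x : V) :
  (\near x, f x = g x) -> differentiable f x -> differentiable g x.
Proof.
move=> fg df; have fgx : f x = g x by exact: nbhs_singleton fg.
have fg0 : \forall y \near (0 : V), f (y + x) = g (y + x).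
  by have := fg; rewrite (near_shift 0) /= subr0.
have cf : continuous ('d f x) by exact: diff_continuous.
have E : g \o shift x = cst (g x) + 'd f x +o_ 0 id.
  apply/eqaddoP => e e0; have /eqaddoP/(_ e e0) dfe := diff_locally df.
  near=> y.
  have /= : `|(f \o shift x - (cst (f x) + 'd f x)) y| <= e * `|y| by near: y.
  rewrite !fctE /= fgx; suff -> : f (y + x) = g (y + x) by [].
  by near: y.
by apply/diff_locallyP; rewrite (diff_unique cf E).
Unshelve. all: by end_near. Qed.

Section SmoothFunctions.
Variables (R : realType) (m : nat).
Implicit Types (V U : set 'rV[R]_m) (f g : 'rV[R]_m -> R).

Lemma smooth_on_differentiable V f x :
  smooth_on V f -> V x -> differentiable f x.
Proof. by move=> sf Vx; exact: (sf [::] x Vx). Qed.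

Lemma smooth_on_derive V f v : smooth_on V f -> smooth_on V ('D_v f).
Proof. by move=> sf s x Vx; have := sf (rcons s v) x Vx; rewrite foldr_rcons. Qed.

Lemma smooth_on_sub V U f : U `<=` V -> smooth_on V f -> smooth_on U f.
Proof. by move=> UV sf s x /UV; exact: sf. Qed.

(* Smoothness is the greatest class of differentiable functions stable under
   directional derivatives. *)
Lemma smooth_on_coind V (P : ('rV[R]_m -> R) -> Prop) :
  (forall f, P f -> (forall x, V x -> differentiable f x) /\
                    forall v, P ('D_v f)) ->
  forall f, P f -> smooth_on V f.
Proof.
move=> coP f Pf s; elim/last_ind: s f Pf => [|s v IH] f Pf x Vx /=.
  exact: (coP f Pf).1.
by rewrite foldr_rcons; apply: IH => //; exact: (coP f Pf).2.
Qed.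

Inductive smooth_alg V : ('rV[R]_m -> R) -> Prop :=
| smooth_alg_gen f : smooth_on V f -> smooth_alg V f
| smooth_alg_add f g : smooth_alg V f -> smooth_alg V g ->
    smooth_alg V (fun x => f x + g x)
| smooth_alg_mul f g : smooth_alg V f -> smooth_alg V g ->
    smooth_alg V (fun x => f x * g x)
| smooth_alg_eq f g : smooth_alg V f -> (forall x, V x -> f x = g x) ->
    smooth_alg V g.

Lemma smooth_alg_differentiable V f x :
  open V -> smooth_alg V f -> V x -> differentiable f x.
Proof.
move=> oV af; elim: af x => {f} [f sf|f g _ IHf _ IHg|f g _ IHf _ IHg|f g _ IHf fg] x Vx.
- exact: smooth_on_differentiable Vx.
- by apply: differentiableD; [exact: IHf|exact: IHg].
- by apply: differentiableM; [exact: IHf|exact: IHg].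
- apply: near_eq_differentiable (IHf x Vx); near=> y; apply: fg; near: y.
  exact: open_nbhs_nbhs.
Unshelve. all: by end_near. Qed.

Lemma smooth_alg_derive V f v :
  open V -> smooth_alg V f -> smooth_alg V ('D_v f).
Proof.
move=> oV; elim=> {f} [f sf|f g af IHf ag IHg|f g af IHf ag IHg|f g af IHf fg].
- exact/smooth_alg_gen/smooth_on_derive.
- apply: smooth_alg_eq (smooth_alg_add IHf IHg) _ => x Vx.
  by rewrite deriveD//; apply: diff_derivable; exact: smooth_alg_differentiable Vx.
- apply: smooth_alg_eq
    (smooth_alg_add (smooth_alg_mul af IHg) (smooth_alg_mul ag IHf)) _ => x Vx.
  by rewrite deriveM//; apply: diff_derivable; exact: smooth_alg_differentiable Vx.
- apply: smooth_alg_eq IHf _ => x Vx; apply: near_eq_derive.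
  by near=> y; apply: fg; near: y; exact: open_nbhs_nbhs.
Unshelve. all: by end_near. Qed.

Lemma smooth_alg_smooth V f : open V -> smooth_alg V f -> smooth_on V f.
Proof.
move=> oV; apply: (smooth_on_coind (P := smooth_alg V)) => {}f af; split.
  by move=> x Vx; exact: smooth_alg_differentiable Vx.
by move=> v; exact: smooth_alg_derive.
Qed.

Lemma smooth_on_cst V (a : R) : smooth_on V (cst a).
Proof.
apply: (@smooth_on_coind _ (fun f => exists b, f = cst b)); last by exists a.
move=> _ [b ->]; split=> [x _|v]; first exact: differentiable_cst.
by exists 0; apply/funext => x; rewrite derive_cst.
Qed.

Lemma smooth_onD V f g : open V -> smooth_on V f -> smooth_on V g ->
  smooth_on V (fun x => f x + g x).
Proof.
by move=> oV sf sg; apply: smooth_alg_smooth => //; apply: smooth_alg_add;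
  apply: smooth_alg_gen.
Qed.

Lemma smooth_onM V f g : open V -> smooth_on V f -> smooth_on V g ->
  smooth_on V (fun x => f x * g x).
Proof.
by move=> oV sf sg; apply: smooth_alg_smooth => //; apply: smooth_alg_mul;
  apply: smooth_alg_gen.
Qed.

Lemma smooth_on_eq V f g : open V -> smooth_on V f ->
  (forall x, V x -> f x = g x) -> smooth_on V g.
Proof.
by move=> oV sf fg; apply: smooth_alg_smooth => //; apply: smooth_alg_eq fg;
  apply: smooth_alg_gen.
Qed.

Lemma smooth_onN V f : open V -> smooth_on V f -> smooth_on V (fun x => - f x).
Proof.
move=> oV sf; apply: smooth_on_eq (smooth_onM oV (@smooth_on_cst V (-1)) sf) _ => //.
by move=> x _; rewrite mulN1r.
Qed.

Lemma smooth_onB V f g : open V -> smooth_on V f -> smooth_on V g ->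
  smooth_on V (fun x => f x - g x).
Proof. by move=> oV sf sg; apply: smooth_onD => //; exact: smooth_onN. Qed.

Lemma smooth_on_sum V (I : Type) (r : seq I) (F : I -> 'rV[R]_m -> R) :
  open V -> (forall i, smooth_on V (F i)) ->
  smooth_on V (fun x => \sum_(i <- r) F i x).
Proof.
move=> oV sF; elim: r => [|i r IH].
  by apply: smooth_on_eq (@smooth_on_cst V 0) _ => // x _; rewrite big_nil.
by apply: smooth_on_eq (smooth_onD oV (sF i) IH) _ => // x _; rewrite big_cons.
Qed.

Lemma derive_coordE f (x v : 'rV[R]_m) : differentiable f x ->
  'D_v f x = \sum_(k < m) v 0 k * 'D_(delta_mx 0 k) f x.
Proof.
move=> df; rewrite deriveE// [in LHS](row_sum_delta v) linear_sum.
by apply: eq_bigr => k _; rewrite linearZ deriveE.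
Qed.

Lemma smooth_on_derive_along V f (X : 'rV[R]_m -> 'rV[R]_m) :
  open V -> smooth_on V f -> (forall k, smooth_on V (fun x => X x 0 k)) ->
  smooth_on V (fun x => 'D_(X x) f x).
Proof.
move=> oV sf sX.
have /smooth_on_eq := @smooth_on_sum V _ (index_enum 'I_m)
  (fun k x => X x 0 k * 'D_(delta_mx 0 k) f x) oV
  (fun k => smooth_onM oV (sX k) (smooth_on_derive _ sf)).
by apply=> // x Vx; rewrite derive_coordE//; exact: smooth_on_differentiable Vx.
Qed.

End SmoothFunctions.

Section ComplexDerivatives.
Variables (R : realType) (m : nat).
Implicit Types (V : set 'rV[R]_m) (F G : 'rV[R]_m -> R[i]) (x v : 'rV[R]_m).

Lemma ReD (z w : R[i]) : complex.Re (z + w) = complex.Re z + complex.Re w.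
Proof. by case: z w => [a b] [c d]. Qed.

Lemma ImD (z w : R[i]) : complex.Im (z + w) = complex.Im z + complex.Im w.
Proof. by case: z w => [a b] [c d]. Qed.

Lemma ReM (z w : R[i]) : complex.Re (z * w) =
  complex.Re z * complex.Re w - complex.Im z * complex.Im w.
Proof. by case: z w => [a b] [c d]. Qed.

Lemma ImM (z w : R[i]) : complex.Im (z * w) =
  complex.Re z * complex.Im w + complex.Im z * complex.Re w.
Proof. by case: z w => [a b] [c d]. Qed.

Lemma ReN (z : R[i]) : complex.Re (- z) = - complex.Re z.
Proof. by case: z. Qed.

Lemma ReZ (a : R) (z : R[i]) : complex.Re (a%:C * z) = a * complex.Re z.
Proof. by case: z => b c; rewrite ReM /= mul0r subr0. Qed.

Lemma Re_conjc (z : R[i]) : complex.Re (conjc z) = complex.Re z.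
Proof. by case: z. Qed.

Lemma Im_conjc (z : R[i]) : complex.Im (conjc z) = - complex.Im z.
Proof. by case: z. Qed.

Lemma Re_sum (I : Type) (r : seq I) (P : pred I) (F : I -> R[i]) :
  complex.Re (\sum_(i <- r | P i) F i) = \sum_(i <- r | P i) complex.Re (F i).
Proof. by apply: (big_morph _ ReD); rewrite raddf0. Qed.

Definition smooth_complex V F : Prop :=
  smooth_on V (fun x => complex.Re (F x)) /\
  smooth_on V (fun x => complex.Im (F x)).

Lemma smooth_complex_cst V (a : R[i]) : smooth_complex V (fun=> a).
Proof. by split; exact: smooth_on_cst. Qed.

Lemma smooth_complexD V F G : open V -> smooth_complex V F -> smooth_complex V G ->
  smooth_complex V (fun x => F x + G x).
Proof.
move=> oV [F1 F2] [G1 G2]; split.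
  by apply: smooth_on_eq (smooth_onD oV F1 G1) _ => // x _; rewrite ReD.
by apply: smooth_on_eq (smooth_onD oV F2 G2) _ => // x _; rewrite ImD.
Qed.

Lemma smooth_complexM V F G : open V -> smooth_complex V F -> smooth_complex V G ->
  smooth_complex V (fun x => F x * G x).
Proof.
move=> oV [F1 F2] [G1 G2]; split.
  have := smooth_onB oV (smooth_onM oV F1 G1) (smooth_onM oV F2 G2).
  by move=> /smooth_on_eq; apply=> // x _; rewrite ReM.
have := smooth_onD oV (smooth_onM oV F1 G2) (smooth_onM oV F2 G1).
by move=> /smooth_on_eq; apply=> // x _; rewrite ImM.
Qed.

Lemma smooth_complex_conjc V F : open V -> smooth_complex V F ->
  smooth_complex V (fun x => conjc (F x)).
Proof.
move=> oV [F1 F2]; split.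
  by apply: smooth_on_eq F1 _ => // x _; rewrite Re_conjc.
by apply: smooth_on_eq (smooth_onN oV F2) _ => // x _; rewrite Im_conjc.
Qed.

Lemma smooth_complex_sum V (I : Type) (r : seq I) (F : I -> 'rV[R]_m -> R[i]) :
  open V -> (forall i, smooth_complex V (F i)) ->
  smooth_complex V (fun x => \sum_(i <- r) F i x).
Proof.
move=> oV sF; elim: r => [|i r [IH1 IH2]].
  by split; apply: smooth_on_eq (@smooth_on_cst _ _ V 0) _ => // x _; rewrite big_nil.
have [H1 H2] := smooth_complexD oV (sF i) (conj IH1 IH2).
by split; [apply: smooth_on_eq H1 _|apply: smooth_on_eq H2 _] => // x _;
  rewrite big_cons.
Qed.

Definition is_cderive x v F (dF : R[i]) : Prop :=
  is_derive x v (fun y => complex.Re (F y)) (complex.Re dF) /\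
  is_derive x v (fun y => complex.Im (F y)) (complex.Im dF).

Lemma is_cderive_cst x v (a : R[i]) : is_cderive x v (fun=> a) 0.
Proof. by split; exact: is_derive_cst. Qed.

Lemma is_cderiveD x v F G dF dG :
  is_cderive x v F dF -> is_cderive x v G dG ->
  is_cderive x v (fun y => F y + G y) (dF + dG).
Proof.
move=> [F1 F2] [G1 G2]; split.
  have := is_deriveD F1 G1; rewrite -ReD.
  by congr is_derive; apply/funext => y /=; rewrite ReD.
have := is_deriveD F2 G2; rewrite -ImD.
by congr is_derive; apply/funext => y /=; rewrite ImD.
Qed.

Lemma is_cderiveM x v F G dF dG :
  is_cderive x v F dF -> is_cderive x v G dG ->
  is_cderive x v (fun y => F y * G y) (dF * G x + F x * dG).
Proof.
move=> [F1 F2] [G1 G2]; split.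
  have := is_deriveB (is_deriveM F1 G1) (is_deriveM F2 G2).
  congr is_derive; first by apply/funext => y /=; rewrite ReM.
  by rewrite ReD !ReM /GRing.scale /=; ring.
have := is_deriveD (is_deriveM F1 G2) (is_deriveM F2 G1).
congr is_derive; first by apply/funext => y /=; rewrite ImM.
by rewrite ImD !ImM /GRing.scale /=; ring.
Qed.

Lemma is_cderive_conjc x v F dF :
  is_cderive x v F dF -> is_cderive x v (fun y => conjc (F y)) (conjc dF).
Proof.
move=> [F1 F2]; split.
  by rewrite Re_conjc; congr is_derive: F1; apply/funext => y; rewrite Re_conjc.
rewrite Im_conjc; have := is_deriveN F2.
by congr is_derive; apply/funext => y /=; rewrite Im_conjc.
Qed.

Lemma is_cderive_sum x v (I : Type) (r : seq I)
    (F : I -> 'rV[R]_m -> R[i]) (dF : I -> R[i]) :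
  (forall i, is_cderive x v (F i) (dF i)) ->
  is_cderive x v (fun y => \sum_(i <- r) F i y) (\sum_(i <- r) dF i).
Proof.
move=> H; elim: r => [|i r IH].
  rewrite big_nil; have := is_cderive_cst x v 0.
  by congr is_cderive; apply/funext => y; rewrite big_nil.
rewrite big_cons; have := is_cderiveD (H i) IH.
by congr is_cderive; apply/funext => y; rewrite big_cons.
Qed.

End ComplexDerivatives.

Section SpinorProduct.
Variables (R : realType) (m : nat).
Local Notation N := (spinor_dim m).
Implicit Types (u v w : 'cV[R[i]]_N) (B C : 'M[R[i]]_N).

Definition adjmx B : 'M[R[i]]_N := (map_mx conjc B)^T.

Lemma adjmxM B C : adjmx (B *m C) = adjmx C *m adjmx B.
Proof. by rewrite /adjmx map_mxM trmx_mul. Qed.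

Lemma adjmxZ (a : R) B : adjmx (a%:C *: B) = a%:C *: adjmx B.
Proof. by rewrite /adjmx map_mxZ linearZ; congr (_ *: _); exact: conjc_real. Qed.

Lemma adjmx_sum (I : Type) (r : seq I) (F : I -> 'M[R[i]]_N) :
  adjmx (\sum_(i <- r) F i) = \sum_(i <- r) adjmx (F i).
Proof. by rewrite /adjmx raddf_sum raddf_sum. Qed.

Lemma spinor_prodE u v : spinor_prod u v = \sum_k conjc (u k 0) * v k 0.
Proof. by rewrite /spinor_prod mxE; apply: eq_bigr => k _; rewrite !mxE. Qed.

Lemma spinor_prodDl u v w :
  spinor_prod (u + v) w = spinor_prod u w + spinor_prod v w.
Proof. by rewrite /spinor_prod map_mxD raddfD /= mulmxDl mxE. Qed.

Lemma spinor_prodDr u v w :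
  spinor_prod u (v + w) = spinor_prod u v + spinor_prod u w.
Proof. by rewrite /spinor_prod mulmxDr mxE. Qed.

Lemma spinor_prodZl (z : R[i]) u v :
  spinor_prod (z *: u) v = conjc z * spinor_prod u v.
Proof.
rewrite !spinor_prodE big_distrr; apply: eq_bigr => k _ /=.
by rewrite mxE rmorphM mulrA.
Qed.

Lemma spinor_prodZr (z : R[i]) u v :
  spinor_prod u (z *: v) = z * spinor_prod u v.
Proof. by rewrite /spinor_prod -scalemxAr mxE. Qed.

Lemma spinor_prodNl u v : spinor_prod (- u) v = - spinor_prod u v.
Proof. by rewrite -scaleN1r spinor_prodZl rmorphN rmorph1 mulN1r. Qed.

Lemma spinor_prodNr u v : spinor_prod u (- v) = - spinor_prod u v.
Proof. by rewrite -scaleN1r spinor_prodZr mulN1r. Qed.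

Lemma spinor_prod0l u : spinor_prod 0 u = 0.
Proof. by rewrite -[0 in LHS](scale0r 0) spinor_prodZl rmorph0 mul0r. Qed.

Lemma spinor_prod0r u : spinor_prod u 0 = 0.
Proof. by rewrite -[0 in LHS](scale0r 0) spinor_prodZr mul0r. Qed.

Lemma spinor_prod_suml (I : Type) (r : seq I) (P : pred I)
    (F : I -> 'cV[R[i]]_N) u :
  spinor_prod (\sum_(i <- r | P i) F i) u =
  \sum_(i <- r | P i) spinor_prod (F i) u.
Proof.
apply: (big_morph (fun w => spinor_prod w u)); last exact: spinor_prod0l.
by move=> *; exact: spinor_prodDl.
Qed.

Lemma spinor_prod_sumr (I : Type) (r : seq I) (P : pred I)
    (F : I -> 'cV[R[i]]_N) u :
  spinor_prod u (\sum_(i <- r | P i) F i) =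
  \sum_(i <- r | P i) spinor_prod u (F i).
Proof.
apply: (big_morph (fun w => spinor_prod u w)); last exact: spinor_prod0r.
by move=> *; exact: spinor_prodDr.
Qed.

Lemma spinor_prod_conjc u v : conjc (spinor_prod u v) = spinor_prod v u.
Proof.
rewrite !spinor_prodE rmorph_sum; apply: eq_bigr => k _.
by rewrite rmorphM /= conjcK mulrC.
Qed.

Lemma Re_spinor_prodC u v :
  complex.Re (spinor_prod u v) = complex.Re (spinor_prod v u).
Proof. by rewrite -spinor_prod_conjc Re_conjc. Qed.

Lemma spinor_prod_adj B u v :
  spinor_prod (B *m u) v = spinor_prod u (adjmx B *m v).
Proof. by rewrite /spinor_prod /adjmx map_mxM trmx_mul mulmxA. Qed.

Variable rho : spinor_module R m.
Local Notation g := (gamma rho).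

Lemma adjmx_gamma j : adjmx (g j) = - g j.
Proof. exact: gamma_skew. Qed.

Lemma spinor_prod_gamma j u v :
  spinor_prod (g j *m u) v = - spinor_prod u (g j *m v).
Proof. by rewrite spinor_prod_adj adjmx_gamma mulNmx spinor_prodNr. Qed.

Lemma adjmx_clifford (x : 'rV[R]_m) : adjmx (clifford rho x) = - clifford rho x.
Proof.
rewrite /clifford adjmx_sum -sumrN; apply: eq_bigr => j _.
by rewrite adjmxZ adjmx_gamma scalerN.
Qed.

Lemma clifford_sqr (x : 'rV[R]_m) :
  clifford rho x *m clifford rho x = (- ((x *m x^T) 0 0)%:C)%:M.
Proof.
have E : clifford rho x *m clifford rho x =
    \sum_j \sum_k (x 0 j * x 0 k)%:C *: (g j *m g k).
  rewrite mulmx_suml; apply: eq_bigr => j _; rewrite mulmx_sumr.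
  apply: eq_bigr => k _.
  by rewrite -scalemxAl -scalemxAr scalerA rmorphM.
have E2 : clifford rho x *m clifford rho x =
    \sum_j \sum_k (x 0 j * x 0 k)%:C *: (g k *m g j).
  rewrite E exchange_big; apply: eq_bigr => j _; apply: eq_bigr => k _.
  by rewrite mulrC.
have n2 : (2 : R[i]) != 0 by rewrite pnatr_eq0.
apply: (scalerI n2); rewrite !scaler_nat mulr2n {1}E E2 -big_split /=.
transitivity (\sum_(j < m) (- (2 * (x 0 j * x 0 j)%:C))%:M : 'M[R[i]]_N).
  apply: eq_bigr => j _; rewrite -big_split /= (bigD1 j) //= big1 ?addr0.
    rewrite -scalerDr gamma_clifford eqxx mulr1 scale_scalar_mx.
    by rewrite mulrN [X in - X]mulrC.
  move=> k kj; rewrite -scalerDr gamma_clifford eq_sym (negbTE kj) mulr0 oppr0.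
  by rewrite scale_scalar_mx mulr0 raddf0.
transitivity ((- ((x *m x^T) 0 0)%:C *+ 2)%:M : 'M[R[i]]_N); last exact: raddfMn.
rewrite -[LHS]raddf_sum; suff -> : \sum_j - (2 * (x 0 j * x 0 j)%:C) =
  - ((x *m x^T) 0 0)%:C *+ 2 by [].
rewrite mxE rmorph_sum sumrN mulNrn; congr (- _).
by rewrite -sumrMnl; apply: eq_bigr => j _; rewrite mxE mulr_natl.
Qed.

Lemma clifford_unitK (x : 'rV[R]_m) B : x *m x^T = 1%:M ->
  clifford rho x *m (clifford rho x *m B) = - B.
Proof.
move=> xx; rewrite mulmxA clifford_sqr xx mxE eqxx mulr1n mul_scalar_mx.
by rewrite rmorph1 scaleN1r.
Qed.

Lemma spin_group_unitary B : spin_group rho B -> adjmx B *m B = 1%:M.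
Proof.
elim=> [|u v C uu vv _ IH]; first by rewrite /adjmx map_mx1 trmx1 mulmx1.
rewrite !adjmxM !adjmx_clifford mulNmx [_ *m - clifford rho u]mulmxN opprK.
by rewrite -!mulmxA clifford_unitK// !mulmxN clifford_unitK// mulmxN opprK.
Qed.

Lemma spinor_prod_unitary B u v : adjmx B *m B = 1%:M ->
  spinor_prod (B *m u) (B *m v) = spinor_prod u v.
Proof. by move=> BB; rewrite spinor_prod_adj mulmxA BB mul1mx. Qed.

Definition spin_connection_mx (w : 'I_m -> 'I_m -> R) : 'M[R[i]]_N :=
  \sum_be \sum_de (4^-1 * w be de)%:C *: (g be *m g de).

Lemma adjmx_spin_connection (w : 'I_m -> 'I_m -> R) :
  (forall be de, w be de = - w de be) ->
  adjmx (spin_connection_mx w) = - spin_connection_mx w.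
Proof.
move=> anti; rewrite /spin_connection_mx [in RHS]exchange_big adjmx_sum.
rewrite -sumrN; apply: eq_bigr => be _; rewrite adjmx_sum -sumrN.
apply: eq_bigr => de _; rewrite adjmxZ.
rewrite adjmxM !adjmx_gamma mulNmx mulmxN opprK anti mulrN.
by rewrite rmorphN scaleNr.
Qed.

Lemma gamma_comm be de al :
  g be *m g de *m g al - g al *m (g be *m g de) =
  (2 * (be == al)%:R) *: g de - (2 * (de == al)%:R) *: g be.
Proof.
have E1 : g de *m g al = - (2 * (de == al)%:R)%:M - g al *m g de.
  by have /(canRL (addrK _)) -> := gamma_clifford rho de al; rewrite raddfN.
have E2 : g al *m g be = - (2 * (be == al)%:R)%:M - g be *m g al.
  have /(canRL (addKr _)) -> := gamma_clifford rho be al.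
  by rewrite raddfN addrC.
rewrite -mulmxA E1 (mulmxA (g al)) E2 mulmxBr mulmxBl mulmxN mulNmx.
by rewrite mul_scalar_mx mul_mx_scalar mulmxA opprB opprK addrA subrK addrC.
Qed.

(* Only the trace of [w], the divergence of the frame, survives. *)
Lemma sum_spin_connection_comm (w : 'I_m -> 'I_m -> 'I_m -> R) :
  (forall al be de, w al be de = - w al de be) ->
  \sum_al (spin_connection_mx (w al) *m g al - g al *m spin_connection_mx (w al))
  = - \sum_be (\sum_al w al be al)%:C *: g be.
Proof.
move=> anti.
have E al : spin_connection_mx (w al) *m g al - g al *m spin_connection_mx (w al)
   = - \sum_be (w al be al)%:C *: g be.
  have -> : spin_connection_mx (w al) *m g al - g al *m spin_connection_mx (w al)
     = \sum_be \sum_de (4^-1 * w al be de)%:C *: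
         ((2 * (be == al)%:R) *: g de - (2 * (de == al)%:R) *: g be).
    rewrite /spin_connection_mx mulmx_suml mulmx_sumr -sumrB.
    apply: eq_bigr => be _; rewrite mulmx_suml mulmx_sumr -sumrB.
    by apply: eq_bigr => de _; rewrite -scalemxAl -scalemxAr -scalerBr gamma_comm.
  under eq_bigr do under eq_bigr do rewrite scalerBr.
  under eq_bigr do rewrite sumrB.
  rewrite sumrB [X in X - _]exchange_big /= -sumrB -sumrN.
  apply: eq_bigr => be _.
  rewrite (bigD1 al)//= eqxx big1 ?addr0; last first.
    by move=> j /negbTE->; rewrite mulr0 scale0r scaler0.
  rewrite (bigD1 al)//= eqxx big1 ?addr0; last first.
    by move=> j /negbTE->; rewrite mulr0 scale0r scaler0.
  rewrite (anti al al be) mulr1n !mulr1 !scalerA -scalerBl -scaleNr.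
  have -> : (2 : R[i]) = (2 : R)%:C by rewrite rmorph_nat.
  by rewrite -!rmorphM -rmorphB -rmorphN; congr (_%:C *: _); field.
under eq_bigr do rewrite E.
rewrite sumrN exchange_big; congr (- _); apply: eq_bigr => be _.
by rewrite rmorph_sum -scaler_suml.
Qed.

End SpinorProduct.

Lemma derive_comp (K : numFieldType) (U V W : normedModType K)
    (f : U -> V) (g : V -> W) (x v : U) :
  differentiable f x -> differentiable g (f x) ->
  'D_v (g \o f) x = 'D_('D_v f x) g (f x).
Proof.
move=> df dg; rewrite deriveE; last exact: differentiable_comp.
by rewrite diff_comp//= -deriveE// -deriveE.
Qed.

Section Charts.
Variables (R : realType) (m : nat) (M : topologicalType).
Variable A : smooth_atlas R m M.
Implicit Types (c d : chart_index A) (p q : M) (U : set M) (f g : M -> R).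

Lemma chart_image_openI c U : open U -> open (chart c @` (U `&` chart_dom c)).
Proof.
move=> oU; rewrite openE => _ [p [Up cp] <-]; rewrite /interior.
have inv_cont := chart_inv_continuous cp.
have oi : nbhs (chart c p) (chart c @` chart_dom c).
  by apply: open_nbhs_nbhs; split; [exact: chart_image_open|exists p].
have nU : nbhs (chart_inv c (chart c p)) U.
  by rewrite chartK//; exact: open_nbhs_nbhs.
have oU' := inv_cont _ nU.
near=> y.
have [q cq qy] : (chart c @` chart_dom c) y by near: y.
have : U (chart_inv c y) by near: y.
by rewrite -qy chartK// => Uq; exists q.
Unshelve. all: by end_near. Qed.

Lemma near_chart c p U (P : 'rV[R]_m -> Prop) :
  open U -> U p -> chart_dom c p ->
  (forall q, U q -> chart_dom c q -> P (chart c q)) ->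
  \forall y \near chart c p, P y.
Proof.
move=> oU Up cp H; have oV := chart_image_openI (c := c) oU.
have : nbhs (chart c p) (chart c @` (U `&` chart_dom c)).
  by apply: open_nbhs_nbhs; split=> //; exists p.
by apply: filterS => _ [q [Uq cq] <-]; exact: H.
Qed.

Lemma dirder_eq c p U v f g : open U -> U p -> chart_dom c p ->
  (forall q, U q -> chart_dom c q -> f q = g q) ->
  dirder c v f p = dirder c v g p.
Proof.
move=> oU Up cp fg; apply: near_eq_derive; apply: (near_chart oU Up cp).
by move=> q Uq cq /=; rewrite chartK// fg.
Qed.

Lemma smooth_fun_differentiable c p U f : smooth_fun A U f -> U p ->
  chart_dom c p -> differentiable (f \o chart_inv c) (chart c p).
Proof.
by move=> sf Up cp; apply: smooth_on_differentiable (sf c) _; exists p.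
Qed.

Lemma dirder_transition c d p U v f : open U -> smooth_fun A U f -> U p ->
  chart_dom c p -> chart_dom d p ->
  dirder c v f p = dirder d (v *m transition_jacobian c d p) f p.
Proof.
move=> oU sf Up cp dp.
have dtr : differentiable (chart d \o chart_inv c) (chart c p).
  by apply: (@chart_transition_smooth _ _ _ A c d [::]); exists p.
have dfd := smooth_fun_differentiable sf Up dp.
have e : (chart d \o chart_inv c) (chart c p) = chart d p by rewrite /= chartK.
have dfd' : differentiable (f \o chart_inv d) ((chart d \o chart_inv c) (chart c p)).
  by rewrite e.
transitivity ('D_v ((f \o chart_inv d) \o (chart d \o chart_inv c)) (chart c p)).
  apply: near_eq_derive; apply: (near_chart (chart_dom_open d) dp cp).
  by move=> q dq cq /=; rewrite !chartK.
by rewrite derive_comp// deriveEjacobian// e.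
Qed.

Lemma dirderD c p v f g :
  differentiable (f \o chart_inv c) (chart c p) ->
  differentiable (g \o chart_inv c) (chart c p) ->
  dirder c v (fun x => f x + g x) p = dirder c v f p + dirder c v g p.
Proof. by move=> df dg; exact: deriveD (diff_derivable df) (diff_derivable dg). Qed.

Lemma dirderN c p v f : differentiable (f \o chart_inv c) (chart c p) ->
  dirder c v (fun x => - f x) p = - dirder c v f p.
Proof. by move=> df; exact: deriveN (diff_derivable df). Qed.

End Charts.

Section LeviCivita.
Variables (R : realType) (m : nat) (M : topologicalType).
Variables (A : smooth_atlas R m M) (h : riemannian_metric A).
Variables (c : chart_index A) (p : M) (cp : chart_dom c p).
Local Notation G := (metric h c p).

Lemma metric_unit : G \in unitmx.
Proof.
rewrite -row_free_unit -kermx_eq0; apply/eqP/row_matrixP => i; apply/eqP.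
rewrite row0; apply/negPn/negP => /(metric_pos h cp).
by rewrite -row_mul mulmx_ker row0 mul0mx mxE ltxx.
Qed.

Lemma metric_symE i j : G i j = G j i.
Proof. by rewrite -[in LHS](Defs.metric_sym h cp) mxE. Qed.

Lemma metric_differentiable k l :
  differentiable ((fun x => metric h c x k l) \o chart_inv c) (chart c p).
Proof.
have : (chart c @` chart_dom c) (chart c p) by exists p.
exact: smooth_on_differentiable (@metric_smooth _ _ _ _ h c k l).
Qed.

Lemma partial_metric_sym q k l :
  partial c q (fun x => metric h c x k l) p =
  partial c q (fun x => metric h c x l k) p.
Proof.
apply: (dirder_eq (U := chart_dom c)) => //; first exact: chart_dom_open.
by move=> x cx _; rewrite -[in LHS](Defs.metric_sym h cx) mxE.
Qed.

Lemma dirder_partial v f : differentiable (f \o chart_inv c) (chart c p) ->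
  dirder c v f p = \sum_(k < m) v 0 k * partial c k f p.
Proof. exact: derive_coordE. Qed.

Definition connection_mx (v : 'rV[R]_m) : 'M[R]_m :=
  \matrix_(l, k) \sum_j christoffel h c p k j l * v 0 j.

Lemma levi_civitaE v (Y : M -> 'rV[R]_m) : levi_civita h c v Y p =
  \row_k dirder c v (fun x => Y x 0 k) p + Y p *m connection_mx v.
Proof.
apply/rowP => k; rewrite !mxE exchange_big; congr (_ + _).
apply: eq_bigr => l _; rewrite mxE big_distrr; apply: eq_bigr => j _ /=.
by rewrite mulrC.
Qed.

Lemma connection_mx_metric v l q : (connection_mx v *m G) l q =
  \sum_j v 0 j * (2^-1 * (partial c j (fun x => metric h c x q l) p
     + partial c l (fun x => metric h c x q j) p
     - partial c q (fun x => metric h c x j l) p)).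
Proof.
rewrite mxE; under eq_bigr do rewrite mxE big_distrl /=.
rewrite exchange_big; apply: eq_bigr => j _ /=.
set d := fun r => partial c j (fun x => metric h c x r l) p
     + partial c l (fun x => metric h c x r j) p
     - partial c r (fun x => metric h c x j l) p.
transitivity (v 0 j * (2^-1 * \sum_r d r * (\sum_k G q k * invmx G k r))).
  under [in RHS]eq_bigr do rewrite mulr_sumr.
  rewrite exchange_big mulr_sumr mulr_sumr; apply: eq_bigr => k _ /=.
  rewrite [\sum_i d i * _](_ : _ = G k q * \sum_r invmx G k r * d r).
    by rewrite /christoffel -/d; ring.
  by rewrite mulr_sumr metric_symE; apply: eq_bigr => r _; ring.
congr (_ * (_ * _)).
have GGV r : \sum_k G q k * invmx G k r = (q == r)%:R.
  by have /matrixP/(_ q r) := mulmxV metric_unit; rewrite !mxE.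
under eq_bigr do rewrite GGV.
rewrite (bigD1 q)//= eqxx mulr1 big1 ?addr0// => r /negbTE.
by rewrite eq_sym => ->; rewrite mulr0.
Qed.

Lemma dirder_metric v k l : dirder c v (fun x => metric h c x k l) p =
  (connection_mx v *m G + G *m (connection_mx v)^T) k l.
Proof.
rewrite dirder_partial; last exact: metric_differentiable.
have -> : G *m (connection_mx v)^T = (connection_mx v *m G)^T.
  by rewrite trmx_mul (Defs.metric_sym h cp).
rewrite mxE [_^T _ _]mxE !connection_mx_metric -big_split /=.
apply: eq_bigr => j _; rewrite -mulrDr; congr (_ * _).
rewrite (partial_metric_sym j l k) (partial_metric_sym l j k).
by rewrite (partial_metric_sym k j l); field.
Qed.

Lemma dirderM v (f g : M -> R) :
  differentiable (f \o chart_inv c) (chart c p) ->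
  differentiable (g \o chart_inv c) (chart c p) ->
  dirder c v (fun x => f x * g x) p = dirder c v f p * g p + f p * dirder c v g p.
Proof.
move=> df dg; rewrite /dirder (deriveM (diff_derivable df) (diff_derivable dg)).
by rewrite /= chartK// addrC [X in X + _]mulrC.
Qed.

Lemma dirder_sum v (I : Type) (r : seq I) (F : I -> M -> R) :
  (forall i, differentiable (F i \o chart_inv c) (chart c p)) ->
  dirder c v (fun x => \sum_(i <- r) F i x) p = \sum_(i <- r) dirder c v (F i) p
  /\ differentiable ((fun x => \sum_(i <- r) F i x) \o chart_inv c) (chart c p).
Proof.
move=> dF; elim: r => [|i r [IH dr]].
  have E : (fun x => \sum_(i <- [::]) F i x) \o chart_inv c = cst 0.
    by apply/funext => x /=; rewrite big_nil.
  by split; rewrite /dirder E; [rewrite derive_cst big_nil|exact: differentiable_cst].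
have E : (fun x => \sum_(i0 <- i :: r) F i0 x) \o chart_inv c =
    (F i \o chart_inv c) + ((fun x => \sum_(i <- r) F i x) \o chart_inv c).
  by apply/funext => x /=; rewrite big_cons.
split; last by rewrite E; exact: differentiableD.
rewrite big_cons -IH /dirder E.
by apply: deriveD; apply: diff_derivable; [exact: dF|exact: dr].
Qed.

Lemma dirder_inner v (Y Z : M -> 'rV[R]_m) :
  (forall k, differentiable ((fun x => Y x 0 k) \o chart_inv c) (chart c p)) ->
  (forall k, differentiable ((fun x => Z x 0 k) \o chart_inv c) (chart c p)) ->
  dirder c v (fun x => inner h c x (Y x) (Z x)) p =
  inner h c p (levi_civita h c v Y p) (Z p) +
  inner h c p (Y p) (levi_civita h c v Z p).
Proof.
move=> dY dZ.
pose F x k l := Y x 0 l * metric h c x l k * Z x 0 k.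
have -> : (fun x => inner h c x (Y x) (Z x)) = fun x => \sum_k \sum_l F x k l.
  apply/funext => x; rewrite /inner mxE; apply: eq_bigr => k _.
  by rewrite !mxE big_distrl.
have dYG k l : differentiable
    ((fun x => Y x 0 l * metric h c x l k) \o chart_inv c) (chart c p).
  exact: (differentiableM (dY l) (metric_differentiable l k)).
have dF k l : differentiable ((fun x => F x k l) \o chart_inv c) (chart c p).
  exact: (differentiableM (dYG k l) (dZ k)).
have sF k := dirder_sum v (index_enum 'I_m) (dF k).
rewrite (dirder_sum v _ (fun k => (sF k).2)).1.
pose DY : 'rV[R]_m := \row_k dirder c v (fun x => Y x 0 k) p.
pose DZ : 'rV[R]_m := \row_k dirder c v (fun x => Z x 0 k) p.
pose DG : 'M[R]_m := \matrix_(k, l) dirder c v (fun x => metric h c x k l) p.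
transitivity ((DY *m G *m (Z p)^T + Y p *m DG *m (Z p)^T + Y p *m G *m DZ^T) 0 0).
  rewrite [RHS]mxE [X in X + _]mxE !mxE -!big_split /=; apply: eq_bigr => k _.
  rewrite (sF k).1 !mxE !mulr_suml -!big_split /=; apply: eq_bigr => l _.
  by rewrite /F dirderM// dirderM//; [rewrite !mxE; ring|exact: metric_differentiable].
have -> : DG = connection_mx v *m G + G *m (connection_mx v)^T.
  by apply/matrixP => k l; rewrite mxE dirder_metric.
rewrite /inner !levi_civitaE -/DY -/DZ [in RHS]raddfD /=.
rewrite mulmxDr !mulmxDl mulmxDr trmx_mul !mulmxA.
by rewrite !mxE; ring.
Qed.

End LeviCivita.

Section Frames.
Variables (R : realType) (m : nat) (M : topologicalType).
Variables (A : smooth_atlas R m M) (h : riemannian_metric A).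
Variables (rho : spinor_module R m) (S : spin_structure h rho).
Implicit Types (c : chart_index A) (a b : triv S) (p : M) (al be de : 'I_m).

Definition frame_mx c a p : 'M[R]_m := \matrix_al frame a al c p.

Lemma row_frame_mx c a p al : row al (frame_mx c a p) = frame a al c p.
Proof. exact: rowK. Qed.

Lemma mul_row_tr_row (k l : nat) (B : 'M[R]_(k, m)) (C : 'M[R]_(l, m)) i j :
  (row i B *m (row j C)^T) 0 0 = (B *m C^T) i j.
Proof. by rewrite !mxE; apply: eq_bigr => q _; rewrite !mxE. Qed.

Lemma frame_mx_gram c a p : chart_dom c p -> triv_dom a p ->
  frame_mx c a p *m metric h c p *m (frame_mx c a p)^T = 1%:M.
Proof.
move=> cp ap; apply/matrixP => al be.
rewrite [in RHS]mxE -(frame_orthonormal al be ap cp) /inner.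
by rewrite -!row_frame_mx -row_mul mul_row_tr_row.
Qed.

Lemma frame_mx_inv c a p : chart_dom c p -> triv_dom a p ->
  metric h c p *m ((frame_mx c a p)^T *m frame_mx c a p) = 1%:M.
Proof.
by move=> cp ap; rewrite mulmxA; apply: mulmx1C; rewrite mulmxA frame_mx_gram.
Qed.

Lemma frame_mx_combination c a p (w : 'I_m -> R) :
  \sum_al w al *: frame a al c p = \row_al w al *m frame_mx c a p.
Proof.
by rewrite mulmx_sum_row; apply: eq_bigr => al _; rewrite mxE rowK.
Qed.

Lemma frame_expansion c a p (u : 'rV[R]_m) : chart_dom c p -> triv_dom a p ->
  \sum_al inner h c p u (frame a al c p) *: frame a al c p = u.
Proof.
move=> cp ap; rewrite frame_mx_combination.
rewrite (_ : \row_al _ = u *m metric h c p *m (frame_mx c a p)^T).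
  by rewrite -!mulmxA frame_mx_inv// mulmx1.
apply/rowP => al; rewrite mxE /inner -row_frame_mx.
by rewrite -[u *m _](row_id 0) mul_row_tr_row row_id.
Qed.

Lemma frameder_sum c a al p f : differentiable (f \o chart_inv c) (chart c p) ->
  frameder c a al f p = \sum_k frame a al c p 0 k * partial c k f p.
Proof. by move=> df; rewrite /frameder dirder_partial. Qed.

Lemma gradient_frame c a p f : chart_dom c p -> triv_dom a p ->
  differentiable (f \o chart_inv c) (chart c p) ->
  gradient h c f p = \sum_al frameder c a al f p *: frame a al c p.
Proof.
move=> cp ap df; rewrite frame_mx_combination /gradient.
have -> : invmx (metric h c p) = (frame_mx c a p)^T *m frame_mx c a p.
  by apply: (can_inj (mulKmx (metric_unit h cp)));
    rewrite frame_mx_inv// mulmxV// metric_unit.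
rewrite mulmxA; congr (_ *m _); apply/rowP => al.
rewrite !mxE frameder_sum//; apply: eq_bigr => k _.
by rewrite !mxE mulrC.
Qed.

Lemma frame_smooth c a al k :
  smooth_on (chart c @` (triv_dom a `&` chart_dom c))
    (fun x => frame a al c (chart_inv c x) 0 k).
Proof. exact: (frame_vector_field a al).2. Qed.

Lemma frame_differentiable c a al k p : chart_dom c p -> triv_dom a p ->
  differentiable ((fun x => frame a al c x 0 k) \o chart_inv c) (chart c p).
Proof.
move=> cp ap.
have : (chart c @` (triv_dom a `&` chart_dom c)) (chart c p) by exists p.
exact: smooth_on_differentiable (@frame_smooth c a al k).
Qed.

Definition frame_connection c a p al be de : R :=
  inner h c p (levi_civita h c (frame a al c p) (frame a be c) p) (frame a de c p).

Lemma frame_connection_anti c a p al be de : chart_dom c p -> triv_dom a p ->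
  frame_connection c a p al be de = - frame_connection c a p al de be.
Proof.
move=> cp ap; apply/eqP; rewrite -addr_eq0 /frame_connection; apply/eqP.
have innerC u v : inner h c p u v = inner h c p v u.
  rewrite /inner; have <- : (u *m metric h c p *m v^T)^T = v *m metric h c p *m u^T.
    by rewrite !trmx_mul trmxK (Defs.metric_sym h cp) mulmxA.
  by rewrite [RHS]mxE.
rewrite [X in _ + X]innerC.
rewrite -(dirder_inner h cp (frame a al c p)); last 2 first.
- by move=> k; exact: frame_differentiable.
- by move=> k; exact: frame_differentiable.
rewrite (dirder_eq _ (triv_dom_open a) (g := fun=> (be == de)%:R))//.
  exact: derive_cst.
by move=> q aq cq; exact: frame_orthonormal.
Qed.

Lemma divergence_frame_trace c a p (Y : M -> 'rV[R]_m) :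
  chart_dom c p -> triv_dom a p ->
  (forall k, differentiable ((fun x => Y x 0 k) \o chart_inv c) (chart c p)) ->
  divergence h c Y p =
  \sum_al inner h c p (levi_civita h c (frame a al c p) Y p) (frame a al c p).
Proof.
move=> cp ap dY.
pose B : 'M[R]_m := \matrix_k levi_civita h c (delta_mx 0 k) Y p.
have LC v : levi_civita h c v Y p = v *m B.
  apply/rowP => k; rewrite [RHS]mxE.
  transitivity (\sum_j v 0 j * levi_civita h c (delta_mx 0 j) Y p 0 k); last first.
    by apply: eq_bigr => j _; rewrite [in RHS]mxE.
  rewrite levi_civitaE 3!mxE dirder_partial//.
  under [in RHS]eq_bigr do rewrite levi_civitaE !mxE mulrDr.
  rewrite big_split /=; congr (_ + _).
  under [in RHS]eq_bigr do rewrite mulr_sumr.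
  rewrite exchange_big /=; apply: eq_bigr => l _.
  rewrite mxE mulr_sumr; apply: eq_bigr => j _.
  rewrite mxE (bigD1 j)//= big1 => [|i ij].
    by rewrite mxE !eqxx addr0 mulr1; ring.
  by rewrite mxE (negbTE ij) andbF mulr0.
transitivity (\tr B).
  by apply: eq_bigr => k _; rewrite [RHS]mxE.
transitivity (\tr (frame_mx c a p *m B *m metric h c p *m (frame_mx c a p)^T)).
  rewrite mxtrace_mulC !mulmxA mxtrace_mulC mulmxA -mulmxA.
  by rewrite mulmxA frame_mx_inv// mul1mx.
apply: eq_bigr => al _; rewrite LC /inner.
rewrite -row_frame_mx -!row_mul; set X := _ *m metric h c p.
by rewrite !mxE; apply: eq_bigr => j _; rewrite !mxE.
Qed.

End Frames.

Section SpinorCalculus.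
Variables (R : realType) (m : nat).
Local Notation N := (spinor_dim m).
Implicit Types (u w : 'rV[R]_m -> 'cV[R[i]]_N).

Lemma smooth_complex_mulmx (V : set 'rV[R]_m) (B : 'M[R[i]]_N) u : open V ->
  (forall k, smooth_complex V (fun x => u x k 0)) ->
  forall k, smooth_complex V (fun x => (B *m u x) k 0).
Proof.
move=> oV su k; under eq_fun do rewrite mxE.
by apply: smooth_complex_sum => // j; apply: smooth_complexM => //;
  exact: smooth_complex_cst.
Qed.

Lemma smooth_complex_spinor_prod (V : set 'rV[R]_m) u w : open V ->
  (forall k, smooth_complex V (fun x => u x k 0)) ->
  (forall k, smooth_complex V (fun x => w x k 0)) ->
  smooth_complex V (fun x => spinor_prod (u x) (w x)).
Proof.
move=> oV su sw; under eq_fun do rewrite spinor_prodE.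
by apply: smooth_complex_sum => // j; apply: smooth_complexM => //;
  exact: smooth_complex_conjc.
Qed.

Lemma is_cderive_mulmx (x v : 'rV[R]_m) (B : 'M[R[i]]_N) u (du : 'cV[R[i]]_N) :
  (forall k, is_cderive x v (fun y => u y k 0) (du k 0)) ->
  forall k, is_cderive x v (fun y => (B *m u y) k 0) ((B *m du) k 0).
Proof.
move=> hu k; under eq_fun do rewrite mxE.
rewrite mxE; apply: is_cderive_sum => j.
have := is_cderiveM (is_cderive_cst x v (B k j)) (hu j).
by rewrite mul0r add0r.
Qed.

Lemma is_cderive_spinor_prod (x v : 'rV[R]_m) u w (du dw : 'cV[R[i]]_N) :
  (forall k, is_cderive x v (fun y => u y k 0) (du k 0)) ->
  (forall k, is_cderive x v (fun y => w y k 0) (dw k 0)) ->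
  is_cderive x v (fun y => spinor_prod (u y) (w y))
    (spinor_prod du (w x) + spinor_prod (u x) dw).
Proof.
move=> hu hw; under eq_fun do rewrite spinor_prodE.
rewrite !spinor_prodE -big_split /=; apply: is_cderive_sum => j.
exact: is_cderiveM (is_cderive_conjc (hu j)) (hw j).
Qed.

End SpinorCalculus.

Section DiracCurrent.
Variables (R : realType) (m : nat) (M : topologicalType).
Variables (A : smooth_atlas R m M) (h : riemannian_metric A).
Variables (rho : spinor_module R m) (S : spin_structure h rho).
Implicit Types (c d : chart_index A) (a b : triv S) (p q : M).
Implicit Types (al be de : 'I_m) (psi eta : spinor_field S) (f g : M -> R).

Local Notation V c a := (chart c @` (triv_dom a `&` chart_dom c)).

Lemma triv_chart_open c a : open (V c a).
Proof. exact/chart_image_openI/triv_dom_open. Qed.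

Lemma spinor_smooth_complex c a psi k :
  smooth_complex (V c a) (fun x => psi a (chart_inv c x) k 0).
Proof. by have [sR sI] := spinor_smooth psi a k; split; [exact: sR|exact: sI]. Qed.

Definition dirac_density psi eta a al p : R :=
  complex.Re (spinor_prod (gamma rho al *m psi a p) (eta a p)).

Lemma dirac_density_smooth psi eta c a al :
  smooth_on (V c a) (dirac_density psi eta a al \o chart_inv c).
Proof.
have oV := @triv_chart_open c a.
suff: smooth_complex (V c a) (fun x => spinor_prod
    (gamma rho al *m psi a (chart_inv c x)) (eta a (chart_inv c x))) by case.
apply: smooth_complex_spinor_prod => // k; last exact: spinor_smooth_complex.
apply: (@smooth_complex_mulmx _ _ _ _ (fun x => psi a (chart_inv c x))) => // j.
exact: spinor_smooth_complex.
Qed.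

Lemma dirac_density_gauge psi eta c a b p :
  chart_dom c p -> triv_dom a p -> triv_dom b p ->
  \sum_al dirac_density psi eta a al p *: frame a al c p =
  \sum_be dirac_density psi eta b be p *: frame b be c p.
Proof.
move=> cp ap bp.
have E be : dirac_density psi eta b be p =
    \sum_al inner h c p (frame a al c p) (frame b be c p) *
            dirac_density psi eta a al p.
  rewrite /dirac_density
    -(spinor_prod_unitary _ _ (spin_group_unitary (lift_spin ap bp))).
  rewrite mulmxA (lift_frame be ap bp cp) -mulmxA -!(spinor_transition _ ap bp).
  rewrite /clifford mulmx_suml spinor_prod_suml Re_sum; apply: eq_bigr => al _.
  by rewrite -scalemxAl spinor_prodZl mxE conjc_real ReZ.
under [RHS]eq_bigr do rewrite E scaler_suml.
rewrite exchange_big; apply: eq_bigr => al _ /=.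
under eq_bigr do rewrite mulrC -scalerA.
by rewrite -scaler_sumr frame_expansion.
Qed.

Lemma frameder_smooth c a al f : smooth_fun A setT f ->
  smooth_on (V c a) (frameder c a al f \o chart_inv c).
Proof.
move=> sf; have oV := @triv_chart_open c a.
have sfV : smooth_on (V c a) (f \o chart_inv c).
  by apply: smooth_on_sub (sf c) => _ [q [_ cq] <-]; exists q.
have := smooth_on_derive_along oV sfV (@frame_smooth _ _ _ _ _ _ S c a al).
move=> /smooth_on_eq; apply=> // _ [q [_ cq] <-].
by rewrite /= /frameder /dirder chartK.
Qed.

Lemma frameder_transition c d a al f p : smooth_fun A setT f ->
  chart_dom c p -> chart_dom d p -> triv_dom a p ->
  frameder c a al f p = frameder d a al f p.
Proof.
move=> sf cp dp ap; rewrite /frameder (dirder_transition _ openT sf _ cp dp)//.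
by rewrite -((frame_vector_field a al).1 c d p).
Qed.

Lemma divergence_combination c a p (w : 'I_m -> M -> R) (Y : M -> 'rV[R]_m) :
  chart_dom c p -> triv_dom a p ->
  (forall al, differentiable (w al \o chart_inv c) (chart c p)) ->
  (forall q, triv_dom a q -> chart_dom c q ->
     Y q = \sum_al w al q *: frame a al c q) ->
  divergence h c Y p =
  \sum_al (frameder c a al (w al) p + w al p * divergence h c (frame a al c) p).
Proof.
move=> cp ap dw YE.
have dwe k al : differentiable
    ((fun x => w al x * frame a al c x 0 k) \o chart_inv c) (chart c p).
  exact: (differentiableM (dw al) (frame_differentiable al k cp ap)).
have dY k : dirder c (delta_mx 0 k) (fun x => Y x 0 k) p =
    \sum_al (partial c k (w al) p * frame a al c p 0 k +
             w al p * partial c k (fun x => frame a al c x 0 k) p).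
  rewrite (dirder_eq _ (triv_dom_open a)
    (g := fun x => \sum_al w al x * frame a al c x 0 k))//; last first.
    by move=> q aq cq; rewrite YE// summxE; apply: eq_bigr => al _; rewrite mxE.
  rewrite (dirder_sum _ _ (dwe k)).1; apply: eq_bigr => al _.
  by rewrite dirderM//; exact: frame_differentiable.
rewrite /divergence; under eq_bigr do
  rewrite levi_civitaE mxE [X in X + _]mxE dY (YE p ap cp)
    mulmx_suml summxE -big_split /=.
rewrite exchange_big; apply: eq_bigr => al _ /=.
rewrite frameder_sum// mulr_sumr -big_split /=; apply: eq_bigr => k _.
by rewrite levi_civitaE -scalemxAl !mxE /partial; ring.
Qed.

Definition frame_derivative c a al psi p : 'cV[R[i]]_(spinor_dim m) :=
  \col_k (frameder c a al (fun x => complex.Re (psi a x k 0)) p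
          +i* frameder c a al (fun x => complex.Im (psi a x k 0)) p).

Lemma spin_connectionE c a al psi p : spin_connection c a al psi p =
  frame_derivative c a al psi p +
  spin_connection_mx rho (frame_connection c a p al) *m psi a p.
Proof.
rewrite /spin_connection /spin_connection_mx mulmx_suml; congr (_ + _).
apply: eq_bigr => be _; rewrite mulmx_suml; apply: eq_bigr => de _.
by rewrite -scalemxAl.
Qed.

Lemma frame_derivativeP c a al psi p k : chart_dom c p -> triv_dom a p ->
  is_cderive (chart c p) (frame a al c p)
    (fun x => psi a (chart_inv c x) k 0) (frame_derivative c a al psi p k 0).
Proof.
move=> cp ap; have [sR sI] := @spinor_smooth_complex c a psi k.
have Vp : V c a (chart c p) by exists p.
by rewrite mxE; split; apply: derivableP; apply: diff_derivable;
  [exact: smooth_on_differentiable sR Vp|exact: smooth_on_differentiable sI Vp].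
Qed.

Lemma frameder_dirac_density psi eta c a al p : chart_dom c p -> triv_dom a p ->
  frameder c a al (dirac_density psi eta a al) p =
  complex.Re (spinor_prod (gamma rho al *m frame_derivative c a al psi p) (eta a p)
    + spinor_prod (gamma rho al *m psi a p) (frame_derivative c a al eta p)).
Proof.
move=> cp ap.
have hpsi k := frame_derivativeP al psi k cp ap.
have heta k := frame_derivativeP al eta k cp ap.
have [dR _] := is_cderive_spinor_prod
  (@is_cderive_mulmx _ _ _ _ (gamma rho al) (fun x => psi a (chart_inv c x)) _ hpsi) heta.
by rewrite (chartK cp) in dR; exact: (@derive_val _ _ _ _ _ _ _ dR).
Qed.

(* The zeroth order terms of the two spin connections combine into a commutator
   with the Clifford multiplication, whose sum cancels the divergence of the
   frame. *)
Lemma divergence_dirac_density psi eta c a p : chart_dom c p -> triv_dom a p ->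
  \sum_al (frameder c a al (dirac_density psi eta a al) p +
           dirac_density psi eta a al p * divergence h c (frame a al c) p) =
  complex.Re (spinor_prod (Defs.dirac c a psi p) (eta a p)) -
  complex.Re (spinor_prod (psi a p) (Defs.dirac c a eta p)).
Proof.
move=> cp ap.
pose Om al := spin_connection_mx rho (frame_connection c a p al).
have anti al be de : frame_connection c a p al be de = - frame_connection c a p al de be.
  exact: frame_connection_anti.
have OmS al u v : spinor_prod u (Om al *m v) = - spinor_prod (Om al *m u) v.
  by rewrite spinor_prod_adj adjmx_spin_connection// mulNmx spinor_prodNr opprK.
have E al : frameder c a al (dirac_density psi eta a al) p =
    complex.Re (spinor_prod (gamma rho al *m spin_connection c a al psi p) (eta a p))
    - complex.Re (spinor_prod (psi a p) (gamma rho al *m spin_connection c a al eta p))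
    + complex.Re (spinor_prod
        ((Om al *m gamma rho al - gamma rho al *m Om al) *m psi a p) (eta a p)).
  rewrite frameder_dirac_density// !spin_connectionE -/(Om al) !mulmxDr mulmxBl.
  rewrite !spinor_prodDl !spinor_prodDr -!ReN.
  rewrite -[X in - (X + _)]opprK -[X in - (_ + X)]opprK -!spinor_prod_gamma.
  rewrite OmS spinor_prodNl !mulmxA -!ReD; congr (complex.Re _).
  by rewrite -!mulmxA; ring.
have D al : divergence h c (frame a al c) p = \sum_be frame_connection c a p be al be.
  by apply: divergence_frame_trace => // k; exact: frame_differentiable.
under eq_bigr do rewrite E.
rewrite !big_split /=.
have -> : \sum_al complex.Re (spinor_prod
    ((Om al *m gamma rho al - gamma rho al *m Om al) *m psi a p) (eta a p)) =
    - \sum_al dirac_density psi eta a al p * divergence h c (frame a al c) p.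
  rewrite -Re_sum -spinor_prod_suml -mulmx_suml sum_spin_connection_comm//.
  rewrite mulNmx spinor_prodNl ReN mulmx_suml spinor_prod_suml Re_sum.
  congr (- _); apply: eq_bigr => al _.
  by rewrite -scalemxAl spinor_prodZl conjc_real ReZ D mulrC.
by rewrite subrK sumrN -!Re_sum -spinor_prod_suml -spinor_prod_sumr.
Qed.

End DiracCurrent.

Section NoetherCurrent.
Variables (R : realType) (m n : nat) (M : topologicalType).
Variables (A : smooth_atlas R m M) (h : riemannian_metric A).
Variables (rho : spinor_module R m) (S : spin_structure h rho) (kappa : R).
Variables (phi : 'I_n.+1 -> M -> R) (psi : 'I_n.+1 -> spinor_field S).
Hypothesis phi_psi : dirac_harmonic_map kappa phi psi.
Variables i k : 'I_n.+1.
Implicit Types (c d : chart_index A) (a : triv S) (p q : M).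

Let phi_smooth j : smooth_fun A setT (phi j) := dh_smooth phi_psi j.

Let phi_differentiable c j p : chart_dom c p ->
  differentiable (phi j \o chart_inv c) (chart c p).
Proof. exact: smooth_fun_differentiable (phi_smooth j) _. Qed.

Definition current_coef c a al p : R :=
  complex.Re (spinor_prod (gamma rho al *m psi i a p) (psi k a p))
  + (frameder c a al (phi i) p * phi k p - phi i p * frameder c a al (phi k) p).

Definition current_in c a p : 'rV[R]_m :=
  \sum_al current_coef c a al p *: frame a al c p.

Definition current c p : 'rV[R]_m := current_in c (projT1 (cid (triv_cover S p))) p.

Lemma current_in_gradient c a p : chart_dom c p -> triv_dom a p ->
  current_in c a p =
  \sum_al dirac_density (psi i) (psi k) a al p *: frame a al c p
  + (phi k p *: gradient h c (phi i) p - phi i p *: gradient h c (phi k) p).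
Proof.
move=> cp ap; rewrite !(gradient_frame cp ap); try exact: phi_differentiable.
rewrite !scaler_sumr -sumrB -big_split; apply: eq_bigr => al _ /=.
by rewrite !scalerA -scalerBl -scalerDl; congr ((_ + (_ - _)) *: _); exact: mulrC.
Qed.

Lemma currentE c a p : chart_dom c p -> triv_dom a p ->
  current c p = current_in c a p.
Proof.
move=> cp ap; rewrite /current; case: cid => b bp /=.
rewrite !current_in_gradient//; congr (_ + _).
exact: dirac_density_gauge.
Qed.

Lemma current_coef_smooth c a al :
  smooth_on (chart c @` (triv_dom a `&` chart_dom c))
    (current_coef c a al \o chart_inv c).
Proof.
have oV := @triv_chart_open _ _ _ _ _ _ S c a.
have sphi j : smooth_on (chart c @` (triv_dom a `&` chart_dom c)) (phi j \o chart_inv c).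
  by apply: smooth_on_sub (@phi_smooth j c) => _ [q [_ cq] <-]; exists q.
apply: (smooth_onD oV (@dirac_density_smooth _ _ _ _ _ _ _ (psi i) (psi k) c a al)).
apply: (smooth_onB oV).
  exact: (smooth_onM oV
    (@frameder_smooth _ _ _ _ _ _ S c a al _ (phi_smooth i)) (sphi k)).
exact: (smooth_onM oV (sphi i) (@frameder_smooth _ _ _ _ _ _ S c a al _ (phi_smooth k))).
Qed.

Lemma current_vector_field : vector_field_on [set: M] current.
Proof.
split=> [c d p _ cp dp|c j].
  have [a ap] := triv_cover S p.
  rewrite (currentE cp ap) (currentE dp ap) mulmx_suml; apply: eq_bigr => al _.
  rewrite -scalemxAl -((frame_vector_field a al).1 c d p)//; congr (_ *: _).
  by rewrite /current_coef !(frameder_transition _ _ cp dp).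
move=> s _ [p [_ cp] <-]; have [a ap] := triv_cover S p.
have oV := @triv_chart_open _ _ _ _ _ _ S c a.
suff sJ : smooth_on (chart c @` (triv_dom a `&` chart_dom c))
    (fun x => current c (chart_inv c x) 0 j) by apply: sJ; exists p.
have /smooth_on_eq := smooth_on_sum (index_enum 'I_m) oV
  (fun al => smooth_onM oV (@current_coef_smooth c a al)
                           (@frame_smooth _ _ _ _ _ _ S c a al j)).
apply=> // _ [q [aq cq] <-]; rewrite (currentE (a := a)) chartK// summxE.
by apply: eq_bigr => al _; rewrite /= chartK// mxE.
Qed.

Lemma laplacian_frame c a f p : smooth_fun A setT f ->
  chart_dom c p -> triv_dom a p ->
  laplacian h c f p = \sum_al (frameder c a al (frameder c a al f) p
    + frameder c a al f p * divergence h c (frame a al c) p).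
Proof.
move=> sf cp ap; apply: (divergence_combination cp ap) => [al|q aq cq].
  have Vp : (chart c @` (triv_dom a `&` chart_dom c)) (chart c p) by exists p.
  exact: smooth_on_differentiable (@frameder_smooth _ _ _ _ _ _ S c a al _ sf) Vp.
by apply: gradient_frame => //; exact: smooth_fun_differentiable sf _ cq.
Qed.

(* By symmetry the gradients pair off, and the vector field
   [phi_k grad phi_i - phi_i grad phi_k] contributes only Laplacians. *)
Lemma divergence_current c a p : chart_dom c p -> triv_dom a p ->
  divergence h c (current c) p =
  (complex.Re (spinor_prod (Defs.dirac c a (psi i) p) (psi k a p)) -
   complex.Re (spinor_prod (psi i a p) (Defs.dirac c a (psi k) p))) +
  (phi k p * laplacian h c (phi i) p - phi i p * laplacian h c (phi k) p).
Proof.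
move=> cp ap; have Vp : (chart c @` (triv_dom a `&` chart_dom c)) (chart c p) by exists p.
rewrite (divergence_combination cp ap (w := current_coef c a)); last 2 first.
- by move=> al; exact: smooth_on_differentiable (@current_coef_smooth c a al) Vp.
- by move=> q aq cq; exact: currentE.
rewrite -divergence_dirac_density// !(laplacian_frame (phi_smooth _) cp ap).
rewrite !mulr_sumr -sumrB -big_split; apply: eq_bigr => al _ /=.
have dd : differentiable (dirac_density (psi i) (psi k) a al \o chart_inv c) (chart c p).
  exact: smooth_on_differentiable
    (@dirac_density_smooth _ _ _ _ _ _ _ (psi i) (psi k) c a al) Vp.
have df j : differentiable (frameder c a al (phi j) \o chart_inv c) (chart c p).
  exact: smooth_on_differentiable
    (@frameder_smooth _ _ _ _ _ _ S c a al _ (phi_smooth j)) Vp.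
have dp j := phi_differentiable j cp.
have dm1 := differentiableM (df i) (dp k).
have dm2 := differentiableM (dp i) (df k).
rewrite {1}/frameder (dirderD _ dd (differentiableB dm1 dm2)).
rewrite (dirderD _ dm1 (differentiableN dm2)) (dirderN _ dm2) !dirderM//.
rewrite -!/(frameder c a al _ p) /current_coef /dirac_density.
move: (frameder c a al (frameder _ _ _ _) p) (frameder c a al (frameder _ _ _ (phi k)) p).
move: (frameder c a al _ p) (frameder c a al (phi i) p) (frameder c a al (phi k) p).
move: (phi i p) (phi k p) (divergence _ _ _ _) (complex.Re _) => *.
ring.
Qed.

Lemma Re_dirac_prod c a p j l : chart_dom c p -> triv_dom a p ->
  complex.Re (spinor_prod (Defs.dirac c a (psi j) p) (psi l a p)) =
  - phi j p * (\sum_al \sum_r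
      complex.Re (spinor_prod (psi l a p) (gamma rho al *m psi r a p))
      * frameder c a al (phi r) p)
  - 2 * kappa * complex.Re
      (\sum_r spinor_prod (psi r a p) (psi r a p) * spinor_prod (psi j a p) (psi l a p)
       - \sum_r spinor_prod (psi j a p) (psi r a p) * spinor_prod (psi r a p) (psi l a p)).
Proof.
move=> cp ap; rewrite (dh_dirac_equation phi_psi j cp ap).
rewrite spinor_prodDl !spinor_prodNl ReD !ReN spinor_prodZl conjc_real ReZ.
congr (_ - _).
  rewrite mulNr spinor_prod_suml Re_sum mulr_sumr; congr (- _); apply: eq_bigr => al _.
  rewrite spinor_prod_suml Re_sum mulr_sumr; apply: eq_bigr => r _.
  rewrite spinor_prodZl conjc_real ReZ [in RHS]Re_spinor_prodC; ring.
congr (_ * complex.Re _).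
rewrite spinor_prodDl spinor_prodNl spinor_prodZl spinor_prod_suml.
congr (_ - _).
  rewrite rmorph_sum mulr_suml; apply: eq_bigr => r _.
  by congr (_ * _); exact: spinor_prod_conjc.
apply: eq_bigr => r _; rewrite spinor_prodZl; congr (_ * _).
exact: spinor_prod_conjc.
Qed.

Lemma current_divergence_free c p : chart_dom c p -> divergence h c (current c) p = 0.
Proof.
move=> cp; have [a ap] := triv_cover S p.
rewrite (divergence_current cp ap) [X in _ - X + _]Re_spinor_prodC !Re_dirac_prod//.
have Q : complex.Re
    (\sum_r spinor_prod (psi r a p) (psi r a p) * spinor_prod (psi k a p) (psi i a p)
     - \sum_r spinor_prod (psi k a p) (psi r a p) * spinor_prod (psi r a p) (psi i a p))
  = complex.Re
    (\sum_r spinor_prod (psi r a p) (psi r a p) * spinor_prod (psi i a p) (psi k a p)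
     - \sum_r spinor_prod (psi i a p) (psi r a p) * spinor_prod (psi r a p) (psi k a p)).
  rewrite -[LHS]Re_conjc rmorphB !rmorph_sum; congr (complex.Re (_ - _)).
    by apply: eq_bigr => r _; rewrite rmorphM /= !spinor_prod_conjc.
  by apply: eq_bigr => r _; rewrite rmorphM /= !spinor_prod_conjc mulrC.
rewrite Q.
have L j := canRL opprK (dh_map_equation phi_psi j cp ap).
rewrite !L.
move: (complex.Re _) (\sum_al _) (\sum_al _) (\sum_(j < n.+1) _) => *.
ring.
Qed.

End NoetherCurrent.

Theorem lemma3p4 (R : realType) (m n : nat) (M : topologicalType)
    (A : smooth_atlas R m M) (h : riemannian_metric A)
    (rho : spinor_module R m) (S : spin_structure h rho) (kappa : R)
    (phi : 'I_n.+1 -> M -> R) (psi : 'I_n.+1 -> spinor_field S)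
    (M_hausdorff : hausdorff_space M) (M_compact : compact [set: M])
    (phi_psi : dirac_harmonic_map kappa phi psi) (i k : 'I_n.+1) :
  exists J : chart_index A -> M -> 'rV[R]_m,
    [/\ vector_field_on [set: M] J,
        (forall c a p, chart_dom c p -> triv_dom a p ->
           J c p =
           \sum_(al < m)
             (complex.Re (spinor_prod (gamma rho al *m psi i a p) (psi k a p))
              + (frameder c a al (phi i) p * phi k p
                 - phi i p * frameder c a al (phi k) p))
             *: frame a al c p)
      & forall c p, chart_dom c p -> divergence h c (J c) p = 0].
Proof.
exists (current phi psi i k); split.
- exact: current_vector_field phi_psi i k.
- by move=> c a p; exact: currentE phi_psi i k c a p.
- by move=> c p; exact: current_divergence_free phi_psi i k c p.
Qed.
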